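(* Let $s$ and $t$ be two processes such that $s\not\approx_{\mathcal{O}}t$. Then there exists a test $T$ that has no probabilistic transitions such that $\mathsf{Res}(s,T)\neq\mathsf{Res}(t,T)$.
   Context: Fix a finite set of actions $\mathcal{A}$. A probabilistic transition system (PTS) is a tuple $(S_n,S_p,\rightarrow,\dashrightarrow)$ where $S_n,S_p$ are finite disjoint sets of nondeterministic and probabilistic states; $\rightarrow\ \subseteq S_n\times\mathcal{A}\times(S_n\cup S_p)$ is an action transition relation such that $(s,a,t),(s,a,t')\in\rightarrow$ implies $t=t'$; and $\dashrightarrow\ \subseteq S_p\times(0,1]\times S_n$ is a probabilistic transition relation with $\sum_{(s,\pi,t)\in\dashrightarrow}\pi=1$ for every $s\in S_p$. A state with no outgoing transitions belongs to $S_n$. Write $s\xrightarrow{a}t$ and $s\overset{\pi}{\dashrightarrow}t$. A process is a state together with all states reachable from it and the transitions between them. For $s\in S_n$, its menu is $I(s)=\{a: s\xrightarrow{a}t \text{ for some } t\}$, and $s_a$ denotes the state with $s\xrightarrow{a}s_a$. Probabilistic ready trace equivalence. Given a process $s$, a set $M\subseteq\mathcal{A}$ and $a\in M$ such that $I(s)=M$ if $s\in S_n$, or otherwise there is $s\dashrightarrow s'$ with $I(s')=M$, the process $s_{(M,a)}$ is: if $s\in S_n$, the process rooted at $s'$ with $s\xrightarrow{a}s'$; if $s\in S_p$, a new root state with, letting $\pi=\sum\{\pi_i : s\overset{\pi_i}{\dashrightarrow}s_i,\ I(s_i)=M\}$, for every $s_i'$ with $s\overset{\pi_i}{\dashrightarrow}s_i\xrightarrow{a}s_i'$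 and $I(s_i)=M$: an edge with probability $\pi_i/\pi$ to $s_i'$ if $s_i'$ has no probabilistic transitions, and for every $s_i'\overset{\rho}{\dashrightarrow}s_i''$ an edge with probability $\pi_i\rho/\pi$ to $s_i''$. A ready trace of length $n$ is $(M_1,a_1,\dots,M_{n-1},a_{n-1},M_n)$ with $M_i\subseteq\mathcal{A}$, $a_i\in M_i$. Define $P^1_s(M)=\sum_{s\overset{\pi}{\dashrightarrow}s'}\pi P^1_{s'}(M)$ if $s\in S_p$, $=1$ if $s\in S_n$ and $I(s)=M$, $=0$ otherwise; for $n>1$, if $P^1_s(M_1)>0$, $P^2_s(M_2\mid M_1,a_1)=P^1_{s_{(M_1,a_1)}}(M_2)$ and $P^n_s(M_n\mid M_1,a_1,\dots,a_{n-1})=P^{n-1}_{s_{(M_1,a_1)}}(M_n\mid M_2,a_2,\dots,a_{n-1})$, and these are undefined if $P^1_s(M_1)=0$. Then $s\approx_{\mathcal{O}}\bar s$ iff $P^1_s(M)=P^1_{\bar s}(M)$ for all $M$, and for all $n>1$ and all ready traces the values $P^n_s(\cdot\mid\cdot)$ and $P^n_{\bar s}(\cdot\mid\cdot)$ are defined for the same ready traces and equal when defined. Testing. Let $\mathcal{R}$ be the set of rational functions generated by $\varphi::=\alpha\mid a\mid\varphi+\varphi\mid\varphi\cdot\varphi\mid\varphi/\varphi$ with $\alpha\ge0$ a scalar and $a\in\mathcal{A}$ a variable; variables range over $(0,\infty)$, and two elements of $\mathcal{R}$ are equal iff they are equal as functions on $(0,\infty)^{|\mathcal{A}|}$. A test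 is a finite process (in a PTS over actions $\mathcal{A}\cup\{\omega\}$, $\omega\notin\mathcal{A}$) in which some states may have $\omega$-transitions. For a process $s$ and test $T$, $\mathsf{Res}(s,T)\in\mathcal{R}$ is defined by: $\mathsf{Res}(s,T)=1$ if $T\xrightarrow{\omega}$; otherwise, if $s\in S_p$, $\mathsf{Res}(s,T)=\sum_{s\overset{\pi_i}{\dashrightarrow}s_i}\pi_i\mathsf{Res}(s_i,T)$; otherwise, if $T$ is probabilistic, $\mathsf{Res}(s,T)=\sum_{T\overset{\pi_i}{\dashrightarrow}T_i}\pi_i\mathsf{Res}(s,T_i)$; otherwise $\mathsf{Res}(s,T)=\sum_{a\in K}\frac{a}{\sum_{b\in K}b}\mathsf{Res}(s_a,T_a)$ with $K=I(s)\cap I(T)$ (an empty sum being $0$). *)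

(* Defs.v *)
From mathcomp Require Import all_boot all_order all_algebra.
From mathcomp Require Import boolp interval_inference reals.

Set Implicit Arguments.
Unset Strict Implicit.
Unset Printing Implicit Defensive.

Import Order.TTheory GRing.Theory Num.Theory.
Local Open Scope ring_scope.

(* Determinism of the action transitions is built in: [act s a] is the unique
   a-successor of [s], if any.  [prob p] enumerates the probabilistic
   transitions of [p] as pairs (probability, target).  It is a list and not a
   set because the process s_(M,a) below may have several transitions with the
   same probability and the same target, and each of them counts. *)
Record pre_pts (R : realType) (A : finType) := PrePTS {
  nstate : finType;
  pstate : finType;
  act : nstate -> A -> option (nstate + pstate);
  prob : pstate -> seq (R * nstate) }.

Definition is_pts (R : realType) (A : finType) (P : pre_pts R A) : Prop :=
  forall p : pstate P,
    (forall e, e \in prob p -> 0 < e.1 <= 1) /\ \sum_(e <- prob p) e.1 = 1.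

Notation state P := (nstate P + pstate P)%type.

(* A process is given by its root; states of the ambient system that are not
   reachable from the root are irrelevant to every notion below. *)
Record pre_process (R : realType) (A : finType) := PreProcess {
  pts_of :> pre_pts R A;
  root : state pts_of }.

Record process (R : realType) (A : finType) := Process {
  process_pre :> pre_process R A;
  processP : is_pts process_pre }.

Definition menu (R : realType) (A : finType) (P : pre_pts R A)
    (n : nstate P) : {set A} :=
  [set a | isSome (act n a)].

Definition step (R : realType) (A : finType) (P : pre_pts R A) :
    rel (state P) :=
  fun x y =>
    match x, y with
    | inl n, _ => [exists a, act n a == Some y]
    | inr p, inl m => has (fun e => e.2 == m) (prob p)
    | inr _, inr _ => false
    end.

Section ReadyTraces.
Variables (R : realType) (A : finType).

Section After.
Variable P : pre_pts R A.

Definition menu_prob (p : pstate P) (M : {set A}) : R :=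
  \sum_(e <- prob p | menu e.2 == M) e.1.

Definition after_edges (p : pstate P) (M : {set A}) (a : A) :
    seq (R * nstate P) :=
  flatten [seq match act e.2 a with
               | Some (inl n) => [:: (e.1 / menu_prob p M, n)]
               | Some (inr q) =>
                   [seq (e.1 * f.1 / menu_prob p M, f.2) | f <- prob q]
               | None => [::]
               end | e <- prob p & menu e.2 == M].

Definition after_lift (x : state P) : nstate P + option (pstate P) :=
  match x with inl n => inl n | inr p => inr (Some p) end.

(* [P] extended with a new probabilistic state [None]. *)
Definition after_pts (p : pstate P) (M : {set A}) (a : A) : pre_pts R A :=
  @PrePTS R A (nstate P) (option (pstate P))
    (fun n b => omap after_lift (act n b))
    (fun o => if o is Some q then prob q else after_edges p M a).

End After.

(* s_(M,a), with [None] standing for undefined. *)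
Definition after (s : pre_process R A) (M : {set A}) (a : A) :
    option (pre_process R A) :=
  if a \in M then
    match root s with
    | inl n => if menu n == M then omap (@PreProcess R A s) (act n a) else None
    | inr p => if has (fun e => menu e.2 == M) (prob p)
               then Some (@PreProcess R A (after_pts p M a) (inr None))
               else None
    end
  else None.

Definition P1 (s : pre_process R A) (M : {set A}) : R :=
  match root s with
  | inl n => (menu n == M)%:R
  | inr p => \sum_(e <- prob p) e.1 * (menu e.2 == M)%:R
  end.

(* [Pn s [:: (M_1, a_1); ...; (M_{n-1}, a_{n-1})] M_n] is
   P^n_s(M_n | M_1, a_1, ..., a_{n-1}), with [None] standing for undefined. *)
Fixpoint Pn (s : pre_process R A) (tr : seq ({set A} * A)) (M : {set A}) :
    option R :=
  match tr with
  | [::] => Some (P1 s M)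
  | (M1, a1) :: tr' =>
      if 0 < P1 s M1 then
        if after s M1 a1 is Some s' then Pn s' tr' M else None
      else None
  end.

(* The sequence (M_1, a_1, ..., M_{n-1}, a_{n-1}, M_n), with [tr] as in [Pn],
   is a ready trace whatever the last menu M_n is. *)
Definition is_ready_trace (tr : seq ({set A} * A)) : bool :=
  all (fun Ma : {set A} * A => Ma.2 \in Ma.1) tr.

Definition ready_trace_equiv (s t : pre_process R A) : Prop :=
  (forall M, P1 s M = P1 t M) /\
  (forall tr M, (0 < size tr)%N -> is_ready_trace tr -> Pn s tr M = Pn t tr M).

Lemma after_is_pts (s s' : pre_process R A) M a :
  is_pts s -> after s M a = Some s' -> is_pts s'.
Proof.
move=> sP; rewrite /after; case: ifP => // aM.
case: (root s) => [n|p].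
  by case: ifP => // _; case: (act n a) => //= y [<-].
case: ifP => // hasM [<-] [q|] /=; first exact: sP.
have [p01 _] := sP p.
set w := menu_prob p M.
have w_ge e : e \in prob p -> menu e.2 == M -> e.1 <= w.
  move=> ep eM; rewrite /w /menu_prob (big_rem e ep) /= eM lerDl.
  rewrite big_seq_cond; apply: sumr_ge0 => f /andP[/mem_rem fp _].
  by have /andP[/ltW] := p01 f fp.
have w_gt0 : 0 < w.
  have /hasP[e ep eM] := hasM.
  by apply: lt_le_trans (w_ge e ep eM); have /andP[] := p01 e ep.
have eact e : menu e.2 == M -> isSome (act e.2 a).
  by move/eqP=> eM; move: aM; rewrite -eM inE.
split.
  move=> f /flattenP[r /mapP[e]]; rewrite mem_filter => /andP[eM ep] ->.
  have /andP[e_gt0 _] := p01 e ep; have ew := w_ge e ep eM.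
  case: (act e.2 a) => [[n|q]|] //.
    by rewrite inE => /eqP -> /=; rewrite divr_gt0 //= ler_pdivrMr // mul1r.
  case/mapP=> g gq -> /=; have [q01 _] := sP q.
  have /andP[g_gt0 g_le1] := q01 g gq.
  rewrite divr_gt0 ?mulr_gt0 //= ler_pdivrMr // mul1r.
  by apply: le_trans ew; rewrite ler_piMr // ltW.
rewrite /after_edges big_flatten big_map big_filter /=.
transitivity (\sum_(e <- prob p | menu e.2 == M) e.1 / w); last first.
  by rewrite -mulr_suml divff // gt_eqF.
apply: eq_bigr => e /eact; case: (act e.2 a) => [[n|q]|] // _.
  by rewrite big_seq1.
rewrite big_map /=; under eq_bigr do rewrite mulrAC.
by rewrite -mulr_sumr; have [_ ->] := sP q; rewrite mulr1.
Qed.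

End ReadyTraces.

Section Testing.
Variables (R : realType) (A : finType).

(* Points of (0,oo)^A.  Elements of the class of rational functions are
   represented by the functions they denote on these points, so that their
   equality is plain equality. *)
Notation point := (A -> {posnum R}).

Inductive is_ratfun : (point -> R) -> Prop :=
| Ratfun_scalar (c : R) : 0 <= c -> is_ratfun (fun _ => c)
| Ratfun_var (a : A) : is_ratfun (fun v => (v a)%:num)
| Ratfun_add f g :
    is_ratfun f -> is_ratfun g -> is_ratfun (fun v => f v + g v)
| Ratfun_mul f g :
    is_ratfun f -> is_ratfun g -> is_ratfun (fun v => f v * g v)
| Ratfun_div f g : is_ratfun f -> is_ratfun g -> (forall v, g v != 0) ->
    is_ratfun (fun v => f v / g v).

(* The action omega is [None : option A].  Since all state spaces are finite,
   the content of finiteness is that there is no infinite path from the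
   root. *)
Record test := Test {
  test_proc :> process R (option A);
  test_finite : Acc (fun y x => step x y) (root test_proc) }.

Definition no_prob_transitions (T : test) : Prop :=
  forall p : pstate T, connect (@step _ _ T) (root T) (inr p) -> prob p = [::].

Section Res.
Variables (P : pre_pts R A) (T : pre_pts R (option A)).

Definition omega (u : state T) : bool :=
  if u is inl m then None \in menu m else false.

Definition common (n : nstate P) (m : nstate T) : {set A} :=
  [set a in menu n | Some a \in menu m].

(* [rec] extends the recursive calls, which are only allowed on successors of
   [u], by 0; the equations [res_omega] to [res_act] below show that
   this default value, and the one for undefined successors, are never used. *)
Fixpoint res (x : state P) (u : state T) (h : Acc (fun y x => step x y) u)
    (v : point) {struct h} : R :=
  let rec (x' : state P) (u' : state T) : R :=
    match decP (@idP (step u u')) with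
    | left su => res x' (Acc_inv h su) v
    | right _ => 0
    end in
  let res_n (n : nstate P) : R :=
    match u with
    | inr q => \sum_(e <- prob q) e.1 * rec (inl n) (inl e.2)
    | inl m =>
        \sum_(a in common n m)
          (v a)%:num / (\sum_(b in common n m) (v b)%:num) *
          match act n a, act m (Some a) with
          | Some na, Some ma => rec na ma
          | _, _ => 0
          end
    end in
  if omega u then 1 else
  match x with
  | inr p => \sum_(e <- prob p) e.1 * res_n e.2
  | inl n => res_n n
  end.

End Res.

Definition Res (s : process R A) (T : test) : point -> R :=
  res (root s) (test_finite T).

Section ResEquations.
Variables (P : pre_pts R A) (T : pre_pts R (option A)).
Implicit Types (x : state P) (u : state T).
Local Notation fin := (Acc (fun y x : state T => step x y)).

Lemma res_irr x u (h h' : fin u) v : res x h v = res x h' v.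
Proof.
elim/Acc_inv_dep: u / h x h' => u h IH x [h'] /=.
have E x' u' :
  match decP (@idP (step u u')) with
  | left su => res x' (h u' su) v | right _ => 0 end =
  match decP (@idP (step u u')) with
  | left su => res x' (h' u' su) v | right _ => 0 end.
  by case: (decP _) => // su; exact: IH.
case: ifP => // _; clear IH; case: x => [n|p]; case: u h h' E => [m|q] h h' E.
- by apply: eq_bigr => a _; case: (act n a) (act m _) => [?|] [?|] //; rewrite E.
- by apply: eq_bigr => e _; rewrite E.
- apply: eq_bigr => e _; congr (_ * _); apply: eq_bigr => a _.
  by case: (act _ a) (act m _) => [?|] [?|] //; rewrite E.
- apply: eq_bigr => e _; congr (_ * _); apply: eq_bigr => f _.
  by rewrite E.
Qed.

Lemma rec_step x u u' (h : forall w, step u w -> fin w) (h' : fin u') v :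
  step u u' ->
  match decP (@idP (step u u')) with
  | left su => res x (h u' su) v | right _ => 0 end = res x h' v.
Proof. by move=> su; case: (decP _) => // su'; exact: res_irr. Qed.

Lemma res_omega x u (h : fin u) v : omega u -> res x h v = 1.
Proof. by case: h => h /= ->. Qed.

Lemma res_prob_proc p u (h : fin u) v : ~~ omega u ->
  res (inr p : state P) h v = \sum_(e <- prob p) e.1 * res (inl e.2) h v.
Proof. by case: h => h /= /negPf ->. Qed.

Lemma step_prob q e : e \in prob q -> step (inr q : state T) (inl e.2).
Proof. by move=> eq; apply/hasP; exists e. Qed.

Lemma step_act (m : nstate T) b u : act m b = Some u -> step (inl m) u.
Proof. by move=> E; apply/existsP; exists b; rewrite E. Qed.

(* [r] lists the values of [Res] at the successors of the test state. *)
Lemma res_prob_test n q (h : fin (inr q)) v (r : nstate T -> R) :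
  (forall e (he : fin (inl e.2)), e \in prob q ->
     r e.2 = res (inl n : state P) he v) ->
  res (inl n : state P) h v = \sum_(e <- prob q) e.1 * r e.2.
Proof.
case: h => h Hr /=; rewrite big_seq [RHS]big_seq; apply: eq_bigr => e eq.
have se := step_prob eq.
by rewrite (rec_step _ _ (h _ se) _ se) (Hr e (h _ se) eq).
Qed.

Lemma res_act (n : nstate P) (m : nstate T) (h : fin (inl m)) v (r : A -> R) :
  ~~ omega (inl m : state T) ->
  (forall a na ma (ha : fin ma), act n a = Some na -> act m (Some a) = Some ma ->
     r a = res na ha v) ->
  res (inl n : state P) h v =
  \sum_(a in common n m)
    (v a)%:num / (\sum_(b in common n m) (v b)%:num) * r a.
Proof.
case: h => h om Hr; move: (om) => /= /negPf ->.
apply: eq_bigr => a; rewrite !inE => /andP[].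
case En: (act n a) => [na|] //; case Em: (act m _) => [ma|] // _ _.
have sa := step_act Em.
by rewrite (rec_step _ _ (h _ sa) _ sa) (Hr a na ma (h _ sa) En Em).
Qed.

End ResEquations.

Lemma is_ratfun_sum (I : eqType) (s : seq I) (C : pred I) (F : I -> point -> R) :
  (forall i, i \in s -> C i -> is_ratfun (F i)) ->
  is_ratfun (fun v => \sum_(i <- s | C i) F i v).
Proof.
elim: s => [_|i s IH Fs].
  rewrite (_ : (fun _ => _) = fun=> 0); first exact: Ratfun_scalar.
  by apply: funext => v; rewrite big_nil.
have IHs : is_ratfun (fun v => \sum_(j <- s | C j) F j v).
  by apply: IH => j js; apply: Fs; rewrite inE js orbT.
have [Ci|nCi] := boolP (C i); last first.
  rewrite (_ : (fun _ => _) = fun v => \sum_(j <- s | C j) F j v) //.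
  by apply: funext => v; rewrite big_cons (negPf nCi).
rewrite (_ : (fun _ => _) = fun v => F i v + \sum_(j <- s | C j) F j v).
  by apply: Ratfun_add => //; apply: Fs => //; rewrite inE eqxx.
by apply: funext => v; rewrite big_cons Ci.
Qed.

Lemma res_ratfun (P : pre_pts R A) (T : pre_pts R (option A)) (x : state P)
    (u : state T) (h : Acc (fun y x => step x y) u) :
  is_pts P -> is_pts T -> is_ratfun (res x h).
Proof.
move=> PP PT.
elim/Acc_inv_dep: u / h x => u h IH x /=.
case: (omega u); first exact: Ratfun_scalar.
have Erec (x' : state P) u' : is_ratfun (fun v =>
    match decP (@idP (step u u')) with
    | left su => res x' (h u' su) v | right _ => 0 end).
  by case: (decP _) => [su|_]; [exact: IH|exact: Ratfun_scalar].
have Eprob (Q : finType) (s : seq (R * Q)) (F : Q -> point -> R) :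
    (forall e, e \in s -> 0 < e.1 <= 1) -> (forall q, is_ratfun (F q)) ->
    is_ratfun (fun v => \sum_(e <- s) e.1 * F e.2 v).
  move=> s01 FP; apply: is_ratfun_sum => e /s01/andP[/ltW e0 _] _.
  by apply: Ratfun_mul => //; exact: Ratfun_scalar.
have En n : is_ratfun (fun v => match u with
    | inr q => \sum_(e <- prob q) e.1 *
        match decP (@idP (step u (inl e.2))) with
        | left su => res (inl n : state P) (h _ su) v | right _ => 0 end
    | inl m => \sum_(a in common n m)
          (v a)%:num / (\sum_(b in common n m) (v b)%:num) *
          match act n a, act m (Some a) with
          | Some na, Some ma =>
              match decP (@idP (step u ma)) with
              | left su => res na (h _ su) v | right _ => 0 end
          | _, _ => 0
          end end).
  clear IH; case: u h Erec => [m|q] h Erec; last first.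
    exact: (Eprob _ _ (fun m v => match decP (@idP (step (inr q) (inl m))) with
      | left su => res (inl n : state P) (h _ su) v | right _ => 0 end)
      (proj1 (PT q)) (fun m => Erec _ _)).
  apply: is_ratfun_sum => a _ aK; apply: Ratfun_mul.
    apply: Ratfun_div; first exact: Ratfun_var.
      by apply: is_ratfun_sum => b _ _; exact: Ratfun_var.
    move=> v; rewrite gt_eqF // (bigD1 a) //=.
    by apply: ltr_pwDl => //; apply: sumr_ge0.
  by case: (act n a) => [na|]; [case: (act m _) => [ma|] //|];
    exact: Ratfun_scalar.
case: x => [n|p]; first exact: En.
exact: Eprob _ _ _ (proj1 (PP p)) En.
Qed.

Lemma Res_ratfun (s : process R A) (T : test) : is_ratfun (Res s T).
Proof. by apply: res_ratfun; exact: processP. Qed.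

End Testing.

(* Main.v *)
(* A test with root menu L that continues as T' after one action a of L and
   deadlocks after the others has, at the point (1, ..., 1), the result
     sum over the menus M containing a of P(M) / |M :&: L| * Res(s_(M,a), T').
   The matrix [1 / |M :&: L|], indexed by the menus and the sets containing a,
   is invertible, since
     1 / |J| = sum over a \in K \subset J of (-1)^(|K|-1) / |K|
   exhibits it as Z D Z^T with Z the zeta matrix of inclusion and D an
   invertible diagonal matrix.  So if T' separates s_(M,a) from t_(M,a) and
   P_s(M) = P_t(M) > 0, some L separates s from t.  Different menu
   distributions are separated by the tests that succeed after any action of
   L: their result is the probability that the menu meets L. *)
From mathcomp Require Import all_boot all_order all_algebra.
From mathcomp Require Import boolp interval_inference reals.
Require Import Defs.

Set Implicit Arguments.
Unset Strict Implicit.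
Unset Printing Implicit Defensive.

Import Order.TTheory GRing.Theory Num.Theory.
Local Open Scope ring_scope.

(** * Invertible linear systems indexed by the subsets of a finite set *)

Section SubsetSums.
Variables (R : numFieldType) (A : finType).
Implicit Types (h : {set A} -> R) (J K L M : {set A}).

(** Induction on [#|M|]: every term of the sum over the subsets of [M] other than [h M] is already
    known to vanish. *)
Lemma sum_subset_eq0 h :
  (forall L, \sum_(M : {set A} | M \subset L) h M = 0) -> forall M, h M = 0.
Proof.
move=> h0 M; have [n] := ubnP #|M|; elim: n M => // n IH M; rewrite ltnS => Mn.
have := h0 M; rewrite (bigD1 M) //= big1 ?addr0 // => K /andP[KM nKM].
by apply: IH; apply: leq_trans Mn; rewrite proper_card // properEneq nKM.
Qed.

Lemma sum_supset_eq0 h :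
  (forall L, \sum_(M : {set A} | L \subset M) h M = 0) -> forall M, h M = 0.
Proof.
move=> h0 M; rewrite -(setCK M).
apply: (@sum_subset_eq0 (fun K => h (~: K))) => L; rewrite -[RHS](h0 (~: L)).
rewrite [RHS](reindex_inj (@setC_inj A)) /=.
by apply: eq_bigl => K; rewrite setCS.
Qed.

Lemma sum_subset_card J (F : nat -> R) :
  \sum_(K : {set A} | K \subset J) F #|K| =
  \sum_(k < #|J|.+1) F k *+ 'C(#|J|, k).
Proof.
have KJ (K : {set A}) : K \subset J -> (#|K| < #|J|.+1)%N.
  by move=> /subset_leq_card; rewrite ltnS.
rewrite (partition_big (fun K : {set A} => inord #|K| : 'I_#|J|.+1) predT) //=.
apply: eq_bigr => k _; rewrite -cards_draws -sumr_const.
apply: eq_big => [K|K /andP[KJs /eqP <-]]; rewrite ?inE; last first.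
  by rewrite inordK ?KJ.
by apply: andb_id2l => /KJ Kk; rewrite -val_eqE /= inordK.
Qed.

(** After multiplication by n+1, the absorption identity (n+1) C(n,k) = (k+1) C(n+1,k+1) turns the
    left side into minus the expansion of (1-1)^(n+1) without its term of index 0. *)
Lemma alternating_bin_sum n :
  \sum_(k < n.+1) ((-1) ^+ k / k.+1%:R *+ 'C(n, k)) = n.+1%:R^-1 :> R.
Proof.
have n0 : n.+1%:R != 0 :> R by rewrite pnatr_eq0.
apply: (mulfI n0); rewrite divff // mulr_sumr.
transitivity (\sum_(k < n.+1) (- ((-1) ^+ k.+1 *+ 'C(n.+1, k.+1))) : R).
  apply: eq_bigr => k _; have k0 : k.+1%:R != 0 :> R by rewrite pnatr_eq0.
  have /(congr1 (fun i => i%:R : R)) := mul_bin_diag n.+1 k.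
  rewrite /= !natrM exprS mulN1r mulNrn opprK => E.
  rewrite -(mulr_natr _ 'C(n, k)) -(mulr_natr _ 'C(n.+1, k.+1)).
  by rewrite mulrCA E mulrA divfK.
have := exprBn 1 (1 : R) n.+1; rewrite subrr expr0n /= big_ord_recl.
rewrite !expr1n !mul1r bin0 sumrN => /eqP.
rewrite eq_sym addr_eq0 => /eqP E; rewrite [RHS]E; congr (- _).
by apply: eq_bigr => k _; rewrite /= !expr1n !mulr1.
Qed.

(** Deleting [a] maps the sets [K] bijectively to the subsets of [J :\ a], which leaves the
    alternating binomial sum. *)
Lemma sum_subset_alternating (a : A) J : a \in J ->
  \sum_(K : {set A} | (a \in K) && (K \subset J)) (-1) ^+ #|K|.-1 / #|K|%:R
  = #|J|%:R^-1 :> R.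
Proof.
move=> aJ; have J1 : #|J| = #|J :\ a|.+1 by rewrite (cardsD1 a J) aJ.
rewrite J1 -alternating_bin_sum.
rewrite -(@sum_subset_card (J :\ a) (fun k => (-1) ^+ k / k.+1%:R)).
rewrite (reindex_onto (fun K => a |: K) (fun K => K :\ a)) /=; last first.
  by move=> K /andP[aK _]; rewrite setD1K.
(* The last conjunct comes from the reindexing and excludes the [K] that already contain [a]. *)
have aN K : ((a \in a |: K) && (a |: K \subset J) && ((a |: K) :\ a == K)) =
    (K \subset J :\ a).
  rewrite setU11 /= subUset sub1set aJ /= subsetD1; congr (_ && _).
  have [aK|aK] := boolP (a \in K); last by rewrite setU1K ?eqxx.
  by apply/negP => /eqP E; move: aK; rewrite -E setD11.
rewrite (eq_bigl _ _ aN); apply: eq_bigr => K.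
by rewrite subsetD1 => /andP[_ aK]; rewrite cardsU1 aK.
Qed.

(** The factors of Z D Z^T are cancelled one by one: [H] is Z^T h, [g] is the diagonal of D, and
    [g K * H K] vanishes because Z is injective. *)
Lemma sum_inv_cardI_eq0 (a : A) h :
  (forall L, a \in L ->
     \sum_(M : {set A} | a \in M) h M / #|M :&: L|%:R = 0) ->
  forall M, a \in M -> h M = 0.
Proof.
move=> h0.
pose H K := \sum_(M : {set A} | (a \in M) && (K \subset M)) h M.
pose g K : R := if a \in K then (-1) ^+ #|K|.-1 / #|K|%:R else 0.
have gH0 : forall K, g K * H K = 0.
  apply: sum_subset_eq0 => L.
  have [aL|aL] := boolP (a \in L); last first.
    apply: big1 => K KL; rewrite /g ifF ?mul0r //.
    by apply/negP => /(subsetP KL); rewrite (negPf aL).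
  rewrite -[RHS](h0 L aL); under eq_bigr do rewrite mulr_sumr.
  rewrite (exchange_big_dep (fun M : {set A} => a \in M)) /=; last first.
    by move=> K M _ /andP[].
  apply: eq_bigr => M aM.
  rewrite -(@sum_subset_alternating a) ?inE ?aM // -mulr_suml mulrC.
  congr (_ * _); rewrite /g -big_mkcondr /=; apply: eq_bigl => K.
  by rewrite subsetI andbC [(K \subset L) && _]andbC.
have H0 K : H K = 0.
  have aH K' : a \in K' -> H K' = 0.
    move=> aK; have /eqP := gH0 K'; rewrite mulf_eq0 => /orP[|/eqP//].
    rewrite /g aK mulf_eq0 signr_eq0 invr_eq0 pnatr_eq0 cards_eq0 => /eqP K0.
    by rewrite K0 inE in aK.
  have [/aH//|aK] := boolP (a \in K).
  (* Every [M] summed in [H] contains [a], so adding [a] to [K] does not change the sum. *)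
  rewrite -[RHS](aH (a |: K)) ?setU11 // /H; apply: eq_bigl => M.
  by rewrite subUset sub1set andbA andbb.
move=> M aM; pose h' K := if a \in K then h K else 0.
suff : h' M = 0 by rewrite /h' aM.
apply: sum_supset_eq0 => L; rewrite -[RHS](H0 L) /h' /H -big_mkcondr /=.
by apply: eq_bigl => K; rewrite andbC.
Qed.

(** The sets that do not meet the complement of [L] are the subsets of [L], so all subset sums
    vanish. *)
Lemma sum_meets_eq0 h :
  \sum_M h M = 0 ->
  (forall L, \sum_(M : {set A} | M :&: L != set0) h M = 0) -> forall M, h M = 0.
Proof.
move=> h0 hL; apply: sum_subset_eq0 => L.
have := h0; rewrite (bigID (fun M => M :&: ~: L != set0)) /= hL add0r => E.
rewrite -[RHS]E; apply: eq_bigl => M.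
by rewrite negbK setI_eq0 disjoints_subset setCK.
Qed.
End SubsetSums.

(** * Results of tests as a total function, and their invariance under morphisms *)

Section TotalRes.
Variables (R : realType) (A : finType).
Implicit Types (P : pre_pts R A) (T : pre_pts R (option A)).
Notation point := (A -> {posnum R}).
Notation finite u := (Acc (fun y x => step x y) u).

(* [res] without the finiteness proof; 0 on tests with an infinite path. *)
Definition tres P T (x : state P) (u : state T) (v : point) : R :=
  if pselect (finite u) is left h then res x h v else 0.

Lemma tresE P T (x : state P) (u : state T) (h : finite u) v :
  res x h v = tres x u v.
Proof. by rewrite /tres; case: pselect => // h'; exact: res_irr. Qed.

(** A nondeterministic state counts as a point distribution, so that one formula serves both kinds
    of root. *)
Definition dist P (x : state P) : seq (R * nstate P) :=
  match x with inl n => [:: (1, n)] | inr p => prob p end.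

Lemma dist_sum P (x : state P) : is_pts P -> \sum_(e <- dist x) e.1 = 1.
Proof.
by move=> PP; case: x => [n|p] /=; [rewrite big_seq1|case: (PP p)].
Qed.

Lemma tres_omega P T (x : state P) (u : state T) v :
  finite u -> omega u -> tres x u v = 1.
Proof. by move=> h om; rewrite -(tresE x h) res_omega. Qed.

Lemma tres_dist P T (x : state P) (u : state T) v :
  is_pts P -> finite u ->
  tres x u v = \sum_(e <- dist x) e.1 * tres (inl e.2) u v.
Proof.
move=> PP h; have [om|om] := boolP (omega u).
  rewrite tres_omega //; under eq_bigr do rewrite tres_omega // mulr1.
  by rewrite dist_sum.
case: x => [n|p] /=; first by rewrite big_seq1 mul1r.
by rewrite -(tresE _ h) res_prob_proc //; apply: eq_bigr => e _; rewrite tresE.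
Qed.

Lemma tres_prob_test P T (n : nstate P) (q : pstate T) v :
  finite (inr q) ->
  tres (inl n) (inr q) v = \sum_(e <- prob q) e.1 * tres (inl n) (inl e.2) v.
Proof.
move=> h; rewrite -(tresE _ h).
by apply: (@res_prob_test _ _ _ _ _ _ _ _
  (fun m => tres (inl n) (inl m) v)) => e he _; rewrite tresE.
Qed.

Lemma tres_act P T (n : nstate P) (m : nstate T) v :
  finite (inl m) -> None \notin menu m ->
  tres (inl n) (inl m) v =
  \sum_(a in common n m) (v a)%:num / (\sum_(b in common n m) (v b)%:num) *
    (if act n a is Some x then
       if act m (Some a) is Some u then tres x u v else 0 else 0).
Proof.
move=> h om; rewrite -(tresE _ h) //.
apply: (@res_act _ _ _ _ _ _ _ _ (fun a => if act n a is Some x then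
       if act m (Some a) is Some u then tres x u v else 0 else 0)) => //.
by move=> a na ma ha -> ->; rewrite tresE.
Qed.

Section Morphism.
Variables (B : finType) (P Q : pre_pts R B).
Variables (fn : nstate P -> nstate Q) (fp : pstate P -> pstate Q).

Definition lift (x : state P) : state Q :=
  match x with inl n => inl (fn n) | inr p => inr (fp p) end.

(** Being equalities, both clauses also reflect transitions: no step leaves the image. The instances
    of interest embed a system into an extension of it by new states. *)
Definition pts_morph :=
  (forall n a, act (fn n) a = omap lift (act n a)) /\
  (forall p, prob (fp p) = [seq (e.1, fn e.2) | e <- prob p]).

Hypothesis f_morph : pts_morph.

Lemma menu_morph n : menu (fn n) = menu n.
Proof. by apply/setP => a; rewrite !inE (proj1 f_morph); case: (act n a). Qed.

Lemma step_morph x y : step (lift x) y -> exists2 x', y = lift x' & step x x'.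
Proof.
have [fa fpr] := f_morph; case: x => [n|p] /=.
  case/existsP=> a; rewrite fa; case E: (act n a) => [x'|//] /= /eqP[<-].
  by exists x' => //; apply/existsP; exists a; rewrite E.
case: y => // m; rewrite fpr => /hasP[_ /mapP[e ep ->]] /= /eqP <-.
by exists (inl e.2) => //; apply/hasP; exists e.
Qed.

Lemma finite_morph x : finite x -> finite (lift x).
Proof.
elim=> {}x _ IH; constructor => y /step_morph[x' -> /IH]; exact.
Qed.

End Morphism.

Lemma tres_morph P P' T T' (fn : nstate P -> nstate P')
    (fp : pstate P -> pstate P') (gn : nstate T -> nstate T')
    (gp : pstate T -> pstate T') (x : state P) (u : state T) v :
  is_pts P -> is_pts P' -> pts_morph fn fp -> pts_morph gn gp -> finite u ->
  tres (lift fn fp x) (lift gn gp u) v = tres x u v.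
Proof.
move=> PP PP' f g hu; elim: (hu) x => {hu}u acc IH.
have hu : finite u by constructor.
have hu' := finite_morph g hu.
(* The induction follows the test only. A probabilistic process state resolves without a move of the
   test, hence is averaged away first. *)
suff Hn n : tres (inl (fn n)) (lift gn gp u) v = tres (inl n) u v.
  case=> [n|p]; first exact: Hn.
  rewrite tres_dist // [RHS]tres_dist //= (proj2 f) big_map.
  by apply: eq_bigr => e _; rewrite Hn.
case: u acc IH hu hu' => [m|q] _ IH hu hu' /=; last first.
  rewrite tres_prob_test // [RHS]tres_prob_test // (proj2 g) big_map.
  rewrite !big_seq; apply: eq_bigr => e eq; congr (_ * _).
  exact: (IH (inl e.2) (step_prob eq) (inl n)).
have [om|om] := boolP (None \in menu m).
  by rewrite !tres_omega //= (menu_morph g).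
rewrite tres_act ?(menu_morph g) // [RHS]tres_act //.
have -> : common (fn n) (gn m) = common n m.
  by rewrite /common (menu_morph f) (menu_morph g).
apply: eq_bigr => a _; rewrite (proj1 f) (proj1 g); congr (_ * _).
case: (act n a) => [x|] //=; case E: (act m _) => [u|] //=.
by apply: IH; exact: step_act E.
Qed.

End TotalRes.

(** * Separation of processes by tests at the point (1, ..., 1) *)

Section Separation.
Variables (R : realType) (A : finType).
Implicit Types (P : pre_pts R A) (T : pre_pts R (option A)) (L M : {set A}).
Notation finite u := (Acc (fun y x => step x y) u).

Definition res1 P T (x : state P) (u : state T) : R :=
  tres x u (fun=> 1%:pos).

(** The unnormalised form of P(M) * Res(s_(M,a), T'): it makes sense even where s_(M,a) is
    undefined. *)
Definition cont P T (x : state P) M a (u : state T) : R :=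
  \sum_(e <- dist x | menu e.2 == M)
    e.1 * (if act e.2 a is Some y then res1 y u else 0).

Lemma pts_morph_id (B : finType) (P : pre_pts R B) :
  @pts_morph R B P P id id.
Proof.
split=> [n a|p]; first by case: (act n a) => [[]|].
by rewrite -[LHS]map_id; apply: eq_map => -[].
Qed.

Lemma res1_after_pts P T (p : pstate P) M a (x : state P) (u : state T) :
  is_pts P -> is_pts (after_pts p M a) -> finite u ->
  res1 (after_lift x : state (after_pts p M a)) u = res1 x u.
Proof.
move=> PP PP' hu; have f : @pts_morph R A P (after_pts p M a) id Some.
  by split=> // q; exact: (proj2 (pts_morph_id P)).
have := tres_morph x (fun=> 1%:pos) PP PP' f (pts_morph_id T) hu.
by rewrite /res1; case: x u {hu} => [?|?] [?|?].
Qed.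

Lemma P1_dist (s : pre_process R A) M :
  P1 s M = \sum_(e <- dist (root s) | menu e.2 == M) e.1.
Proof.
have -> : P1 s M = \sum_(e <- dist (root s)) e.1 * (menu e.2 == M)%:R.
  by rewrite /P1; case: (root s) => [n|p] //=; rewrite big_seq1 mul1r.
rewrite [RHS]big_mkcond; apply: eq_bigr => e _.
by case: eqP; rewrite ?mulr1 ?mulr0.
Qed.

Lemma P1_sum (s : pre_process R A) : is_pts s -> \sum_M P1 s M = 1.
Proof.
move=> sP; rewrite -(dist_sum (root s) sP); under eq_bigr do rewrite P1_dist.
by rewrite [RHS](partition_big (fun e => menu e.2) predT).
Qed.

(** The factor [P1 s M] cancels the normalisation of the edges of s_(M,a). *)
Lemma cont_after (s s' : pre_process R A) M a T (u : state T) :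
  is_pts s -> after s M a = Some s' -> finite u -> 0 < P1 s M ->
  cont (root s) M a u = P1 s M * res1 (root s') u.
Proof.
move=> sP sE hu; have sP' := after_is_pts sP sE; move: sE sP'.
rewrite P1_dist /after; case: ifP => // _.
case: s sP => P [n|p] /= PP.
  case: ifP => // nM; case E: (act n a) => [y|] //= [<-] /= _ _.
  by rewrite /cont big_mkcond big_seq1 /= nM E big_mkcond big_seq1 nM.
case: ifP => // _ [<-] /= PP' w0.
rewrite [X in _ * X]/res1 tres_dist //= /after_edges big_flatten big_map.
rewrite big_filter /= mulr_sumr; apply: eq_bigr => e eM.
have w : menu_prob p M != 0 by rewrite gt_eqF.
rewrite -/(menu_prob p M).
case: (act e.2 a) => [[n|q]|]; last by rewrite big_nil !mulr0.
  rewrite big_seq1 /= mulrA mulrCA divff // mulr1.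
  by rewrite -(@res1_after_pts _ _ p M a (inl n)).
(* The edges of s_(M,a) bypass the probabilistic successor [q]; averaging the result at [q] over its
   distribution matches them. *)
rewrite big_map /= [res1 _ _]tres_dist //= !mulr_sumr; apply: eq_bigr => f _.
rewrite -[tres (inl f.2) u _](@res1_after_pts _ _ p M a (inl f.2)) //=.
by rewrite [RHS]mulrA [in RHS]mulrCA divff // mulr1 mulrA.
Qed.

Section PrefixTest.
Variables (T : pre_pts R (option A)) (r : state T) (L : {set A}) (C : pred A).

(* [None] is the new root and [Some None] a deadlock. *)
Definition prefix_lift (x : state T) : option (option (nstate T)) + pstate T :=
  match x with inl m => inl (Some (Some m)) | inr q => inr q end.

(** [C] selects the actions after which the test goes on as [r]: a single one to compare
    continuations, all of them to compare menu distributions. *)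
Definition prefix_pts : pre_pts R (option A) :=
  @PrePTS R (option A) (option (option (nstate T))) (pstate T)
    (fun m b => match m, b with
       | Some (Some m'), _ => omap prefix_lift (act m' b)
       | None, Some a =>
           if a \in L then Some (if C a then prefix_lift r else inl (Some None))
           else None
       | _, _ => None
       end)
    (fun q => [seq (e.1, Some (Some e.2)) | e <- prob q]).

Definition prefix_root : state prefix_pts := inl None.
Definition prefix_dead : state prefix_pts := inl (Some None).

Lemma prefix_morph :
  @pts_morph R _ T prefix_pts (fun m => Some (Some m)) id.
Proof. by []. Qed.

Hypothesis r_finite : finite r.

Lemma prefix_dead_finite : finite prefix_dead.
Proof. by constructor => y /existsP[]. Qed.

Lemma prefix_lift_finite : finite (prefix_lift r : state prefix_pts).
Proof. exact: (finite_morph prefix_morph r_finite). Qed.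

Lemma prefix_root_finite : finite prefix_root.
Proof.
constructor => y /existsP[[a|/eqP//]] /=.
have [_|_] := boolP (a \in L); last by move/eqP.
case/eqP=> <-.
by case: (C a); [exact: prefix_lift_finite|exact: prefix_dead_finite].
Qed.

Lemma res1_prefix_lift P (x : state P) : is_pts P ->
  res1 x (prefix_lift r : state prefix_pts) = res1 x r.
Proof.
move=> PP.
have := tres_morph x (fun=> 1%:pos) PP PP (pts_morph_id P) prefix_morph
  r_finite.
by rewrite /res1; case: x r => [?|?] [?|?].
Qed.

Lemma res1_prefix_dead P (x : state P) : is_pts P -> res1 x prefix_dead = 0.
Proof.
move=> PP; have df := prefix_dead_finite; rewrite /res1 tres_dist //.
apply: big1 => e _; rewrite tres_act ?inE // big1 ?mulr0 // => a.
by rewrite !inE andbF.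
Qed.

(** At this point all common actions have equal weight, and those outside [C] lead to the
    deadlock. *)
Lemma res1_prefix_root P (n : nstate P) : is_pts P ->
  res1 (inl n) prefix_root =
  (\sum_(a in menu n :&: L | C a) (if act n a is Some x then res1 x r else 0))
    / #|menu n :&: L|%:R.
Proof.
move=> PP; have rf := prefix_root_finite; rewrite /res1 tres_act ?inE //.
have -> : common n (None : nstate prefix_pts) = menu n :&: L.
  by apply/setP => a; rewrite !inE /=; case: (a \in L).
rewrite /= sumr_const big_mkcondr mulr_suml.
apply: eq_bigr => a /setIP[_ aL]; rewrite aL mul1r mulrC; congr (_ * _).
case: (act n a) => [x|]; last by rewrite if_same.
by case: (C a); [exact: res1_prefix_lift|exact: res1_prefix_dead].
Qed.

End PrefixTest.

Lemma res1_prefix1 P T (r : state T) L a (x : state P) :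
  is_pts P -> finite r -> a \in L ->
  res1 x (prefix_root r L (pred1 a)) =
  \sum_(M : {set A} | a \in M) cont x M a r / #|M :&: L|%:R.
Proof.
move=> PP rf aL; have pf := prefix_root_finite L (pred1 a) rf.
rewrite /res1 tres_dist //.
transitivity (\sum_(e <- dist x | a \in menu e.2)
    e.1 * (if act e.2 a is Some y then res1 y r else 0)
     / #|menu e.2 :&: L|%:R).
  rewrite [RHS]big_mkcond; apply: eq_bigr => e _.
  rewrite [tres _ _ _]res1_prefix_root // mulrA.
  have [ae|ae] := boolP (a \in menu e.2).
    rewrite (big_pred1 a) // => b; rewrite in_setI /=.
    by case: eqP => [->|]; rewrite ?andbF // ae aL.
  rewrite big_pred0 ?mulr0 ?mul0r // => b; apply/negP => /andP[/setIP[be _]].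
  by move/eqP=> ba; rewrite -ba be in ae.
rewrite (partition_big (fun e => menu e.2) (fun M => a \in M)) //=.
apply: eq_bigr => M aM; rewrite mulr_suml.
apply: eq_big => [e|e /andP[_ /eqP->]] //.
by case: eqP => [->|]; rewrite ?aM ?andbF.
Qed.

Definition omega_pts : pre_pts R (option A) :=
  @PrePTS R (option A) bool void
    (fun m b => if m && (b == None) then Some (inl false) else None)
    (fun q => match q with end).

Definition omega_root : state omega_pts := inl true.

Lemma omega_root_finite : finite omega_root.
Proof.
constructor => y /existsP[[a|] /= /eqP]; first by [].
case=> <-.
by constructor => z /existsP[].
Qed.

Lemma res1_omega_root P (x : state P) : res1 x omega_root = 1.
Proof.
by apply: tres_omega; [exact: omega_root_finite | rewrite /= inE].
Qed.

Lemma res1_prefix_omega (s : pre_process R A) L : is_pts s ->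
  res1 (root s) (prefix_root omega_root L predT) =
  \sum_(M : {set A} | M :&: L != set0) P1 s M.
Proof.
move=> PP; have of_ := omega_root_finite.
have pf := prefix_root_finite L predT of_; rewrite /res1 tres_dist //.
under [RHS]eq_bigr do rewrite P1_dist.
transitivity (\sum_(e <- dist (root s) | menu e.2 :&: L != set0) e.1).
  rewrite [RHS]big_mkcond; apply: eq_bigr => e _.
  rewrite [tres _ _ _]res1_prefix_root //.
  have -> : \sum_(a in menu e.2 :&: L | predT a)
      (if act e.2 a is Some x then res1 x omega_root else 0) =
      #|menu e.2 :&: L|%:R.
    rewrite -sumr_const; apply: eq_big => [a|a]; first by rewrite andbT.
    rewrite andbT !inE => /andP[+ _].
    by case: (act e.2 a) => [y|] // _; exact: res1_omega_root.
  (* For a menu disjoint from [L] the quotient 0 / 0 is 0, which is the value of the empty sum. *)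
  have [->|ML] := eqVneq; first by rewrite cards0 mul0r mulr0.
  by rewrite divff ?mulr1 // pnatr_eq0 cards_eq0.
rewrite (partition_big (fun e => menu e.2) (fun M => M :&: L != set0)) //=.
apply: eq_bigr => M ML; apply: eq_bigl => e.
by case: (menu e.2 =P M) => [->|]; rewrite ?ML ?andbF.
Qed.

(** Positive probability provides a state with menu [M]; hence on ready traces [P1] alone decides
    where [Pn] is defined. *)
Lemma after_defined (s : pre_process R A) M a :
  a \in M -> 0 < P1 s M -> exists s', after s M a = Some s'.
Proof.
move=> aM; rewrite P1_dist /after aM; case: (root s) => [n|p] /= s0.
  move: s0; rewrite big_mkcond big_seq1 /=; case: eqP => [nM _|]; last first.
    by rewrite ltxx.
  by move: aM; rewrite -nM inE; case: (act n a) => // y; exists (PreProcess y).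
case: hasP => [_|nh]; first by eexists.
move: s0; rewrite big_seq_cond big_pred0 ?ltxx // => e.
by apply/negP => /andP[ep eM]; apply: nh; exists e.
Qed.

(** Having no probabilistic states at all is preserved by prefixing and makes [is_pts] vacuous for
    the test. *)
Definition separated (s t : pre_process R A) : Prop :=
  exists (T : pre_pts R (option A)) (r : state T),
    [/\ pstate T -> False, finite r & res1 (root s) r <> res1 (root t) r].

Lemma separated_P1 (s t : pre_process R A) M :
  is_pts s -> is_pts t -> P1 s M <> P1 t M -> separated s t.
Proof.
move=> sP tP stM; apply: contrapT => nsep; apply: stM; apply/eqP.
(* The difference of the menu distributions has total 0, and without a separating test it sums to 0
   over the menus meeting any [L]. *)
rewrite -subr_eq0; apply/eqP; move: M.
apply: sum_meets_eq0 => [|L]; rewrite sumrB; first by rewrite !P1_sum // subrr.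
rewrite -!res1_prefix_omega //; apply/eqP; rewrite subr_eq0; apply/eqP.
apply: contrapT => neq; apply: nsep.
exists (prefix_pts omega_root L predT), (prefix_root omega_root L predT).
split; [by case | exact/prefix_root_finite/omega_root_finite | exact: neq].
Qed.

(** The set [L] is not constructed: if the prefixed test failed for every [L] containing [a],
    invertibility would equate all contributions, and the positive factor [P1 s M] cancels. *)
Lemma separated_after (s t s' t' : pre_process R A) M a :
  is_pts s -> is_pts t -> a \in M -> P1 s M = P1 t M -> 0 < P1 s M ->
  after s M a = Some s' -> after t M a = Some t' ->
  separated s' t' -> separated s t.
Proof.
move=> sP tP aM stM s0 sE tE [T [r [T0 rf neq]]].
apply: contrapT => nsep; apply: neq; apply: (mulfI (lt0r_neq0 s0)).
rewrite -(cont_after sP sE) // stM -(cont_after tP tE) -?stM //.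
apply/eqP; rewrite -subr_eq0; apply/eqP.
apply: (@sum_inv_cardI_eq0 _ _ a
  (fun K => cont (root s) K a r - cont (root t) K a r)) => // L aL.
under eq_bigr do rewrite mulrBl.
rewrite sumrB -!res1_prefix1 //; apply/eqP; rewrite subr_eq0; apply/eqP.
apply: contrapT => neq; apply: nsep.
exists (prefix_pts r L (pred1 a)), (prefix_root r L (pred1 a)).
by split; [exact: T0 | exact: prefix_root_finite | exact: neq].
Qed.

Lemma separated_Pn tr M (s t : pre_process R A) :
  is_pts s -> is_pts t -> is_ready_trace tr -> Pn s tr M <> Pn t tr M ->
  separated s t.
Proof.
elim: tr s t => [|[M1 a1] tr IH] s t sP tP /=.
  by move=> _ neq; apply: (@separated_P1 _ _ M) => // E; apply: neq; rewrite E.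
case/andP=> aM rtr.
(* Either the first menu already separates, or both sides proceed to their successors under the same
   condition. *)
have [E|/separated_P1 sep _] := pselect (P1 s M1 = P1 t M1); last exact: sep.
rewrite -E; case: ifP => // s0.
have [s' sE] := after_defined aM s0.
have [|t' tE] := after_defined (s := t) aM; first by rewrite -E.
rewrite sE tE => /(IH s' t' (after_is_pts sP sE) (after_is_pts tP tE) rtr).
exact: separated_after sE tE.
Qed.

End Separation.

Theorem theorem5 (R : realType) (A : finType) (s t : process R A) :
  ~ ready_trace_equiv s t ->
  exists T : test R A, no_prob_transitions T /\ Res s T <> Res t T.
Proof.
move=> nst; have [T [r [T0 rf neq]]] : separated s t.
  apply: contrapT => nsep; apply: nst.
  have E tr M : is_ready_trace tr -> Pn s tr M = Pn t tr M.
    move=> rtr; apply: contrapT => neq; apply: nsep.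
    by apply: separated_Pn rtr neq; exact: processP.
  (* The empty trace yields the clause on [P1]. *)
  by split=> [M|tr M _ /E //]; have [] := E [::] M isT.
have TP : is_pts (PreProcess r) by move=> q; case: (T0 q).
exists (@Test R A (@Process R (option A) (PreProcess r) TP) rf).
split=> [q|/(congr1 (fun f => f (fun=> 1%:pos)))]; first by case: (T0 q).
by rewrite /Res !tresE.
Qed.
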